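(* For every integer $d \ge 3$ there exist a constant $c$ and infinitely many pairwise non-isomorphic hamiltonian $3$-connected graphs with minimum degree $d$, each of which contains at most $c$ hamiltonian cycles.
   Context: Graphs are finite and simple. A hamiltonian cycle is a cycle through all vertices of the graph; a graph is hamiltonian if it has one. *)

(* Defs.v *)
From mathcomp Require Import all_boot.

Set Implicit Arguments.
Unset Strict Implicit.
Unset Printing Implicit Defensive.

Record sgraph := SGraph {
  vertex :> finType;
  edge : rel vertex;
  edge_sym : symmetric edge;
  edge_irrefl : irreflexive edge
}.

Definition isomorphic (G H : sgraph) : Prop :=
  exists2 f : G -> H, bijective f & forall x y, edge (f x) (f y) = edge x y.

Definition degree (G : sgraph) (x : G) : nat := #|[set y | edge x y]|.

(* Every degree is less than #|G|, so the unit #|G| is attained only by the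
   graph without vertices. *)
Definition min_degree (G : sgraph) : nat := \big[minn/#|G|]_(x : G) degree x.

Definition del_edge (G : sgraph) (S : {set G}) : rel G :=
  [rel x y | [&& x \notin S, y \notin S & edge x y]].

Definition connected_del (G : sgraph) (S : {set G}) : Prop :=
  forall x y : G, x \notin S -> y \notin S -> connect (del_edge S) x y.

Definition k_connected (k : nat) (G : sgraph) : Prop :=
  k < #|G| /\ forall S : {set G}, #|S| < k -> connected_del S.

(* ucycleb says that consecutive vertices, cyclically, are adjacent and that no
   vertex is repeated; a cycle has length at least 3. *)
Definition ham_seq (G : sgraph) (c : seq G) : bool :=
  [&& 2 < size c, ucycleb (@edge G) c & [forall x : G, x \in c]].

Definition cycle_edges (G : sgraph) (c : seq G) : {set {set G}} :=
  [set [set x; next c x] | x in c].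

(* A hamiltonian cycle is a subgraph, identified with its edge set, so that the
   starting point and the direction of a traversal are immaterial. *)
Definition ham_cycles (G : sgraph) : {set {set {set G}}} :=
  [set cycle_edges c | c : #|G|.-tuple G & ham_seq c].

Definition hamiltonian (G : sgraph) : Prop :=
  exists C : {set {set G}}, C \in ham_cycles G.

(* Main.v *)
(** Take a clique [B] and an independent set [A] with [#|A| = #|B|]. A
    hamiltonian cycle must alternate between [A] and [B], so the edges inside
    [B] are useless to it, although they provide connectivity and large degrees
    in [B]. Let the vertex [a_i], [0 < i], be adjacent to [b_(i-1), ..., b_(i+d-2)],
    and [a_0] to [b_0], and complete this at the far end of the index range with
    a block of size depending only on [d]. The vertex [b_0] is adjacent in [A]
    to [a_0] and [a_1] only, hence a hamiltonian cycle contains [a_0 b_0 a_1].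
    Inductively, once it contains [a_0 b_0 a_1 ... b_(j-1) a_j], all the
    neighbours of [b_j] in [A] other than [a_j] and [a_(j+1)] already have two
    cycle edges, so that it continues with [b_j a_(j+1)]. All the freedom is thus
    in the end block, whatever the length of the forced path. *)

Require Import Defs.
From mathcomp Require Import all_boot zify.

Set Implicit Arguments.
Unset Strict Implicit.
Unset Printing Implicit Defensive.

Lemma del_edge_sym (G : sgraph) (S : {set G}) : symmetric (del_edge S).
Proof. by move=> x y; rewrite /del_edge /= edge_sym andbCA. Qed.

(** * Neighbours along a hamiltonian cycle *)

Section HamiltonianSequences.

Variables (G : sgraph) (c : seq G).
Hypothesis ham_c : ham_seq c.

Definition cycle_nbrs (x : G) : {set G} := [set next c x; prev c x].

Lemma ham_seq_mem x : x \in c.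
Proof. by case/and3P: ham_c => _ _ /forallP/(_ x). Qed.

Lemma ham_seq_uniq : uniq c.
Proof. by case/and3P: ham_c => _ /andP[]. Qed.

Lemma edge_next x : edge x (next c x).
Proof.
case/and3P: ham_c => _ /andP[cyc_c _] _.
exact: next_cycle cyc_c (ham_seq_mem x).
Qed.

Lemma edge_prev x : edge x (prev c x).
Proof. by rewrite edge_sym -{2}(next_prev ham_seq_uniq x) edge_next. Qed.

Lemma edge_cycle_nbrs x y : y \in cycle_nbrs x -> edge x y.
Proof. by rewrite !inE => /orP[]/eqP->; rewrite ?edge_next ?edge_prev. Qed.

Lemma cycle_nbrs_sym x y : (y \in cycle_nbrs x) = (x \in cycle_nbrs y).
Proof.
have Uc := ham_seq_uniq; rewrite !inE.
by apply/orP/orP => -[]/eqP->; rewrite ?(prev_next Uc) ?(next_prev Uc) eqxx; auto.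
Qed.

(** If the two agreed, two steps from [x] would lead back to [x], which more than two distinct
    vertices exclude; rotating [x] to the front makes this explicit. *)
Lemma next_neq_prev x : next c x != prev c x.
Proof.
have Uc := ham_seq_uniq; have [size_c _ _] := and3P ham_c.
have [i s def_c] := rot_to (ham_seq_mem x).
rewrite -(next_rot i Uc) -(prev_rot i Uc).
move: Uc size_c; rewrite -(rot_uniq i) -(size_rot i) def_c => Us.
apply: contraTneq => eq_np.
have := next_prev Us x; rewrite -eq_np.
case: s Us {def_c eq_np} => [|y [|z s]] //=.
rewrite !inE !negb_or eqxx => /and3P[/and3P[nxy nxz _] _ _].
by rewrite eq_sym (negPf nxy) eqxx => eq_zx; rewrite eq_zx eqxx in nxz.
Qed.

Lemma card_cycle_nbrs x : #|cycle_nbrs x| = 2.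
Proof. by rewrite cards2 next_neq_prev. Qed.

Lemma cycle_edgesP (e : {set G}) :
  reflect (exists x, e = [set x; next c x]) (e \in cycle_edges c).
Proof.
apply: (iffP imsetP) => [[x _ ->]|[x ->]]; exists x => //.
exact: ham_seq_mem.
Qed.

Lemma cycle_nbrs_edge x y : y \in cycle_nbrs x -> [set x; y] \in cycle_edges c.
Proof.
rewrite !inE => /orP[]/eqP->; apply/cycle_edgesP; first by exists x.
by exists (prev c x); rewrite // (next_prev ham_seq_uniq) setUC.
Qed.

(** The injection [next c] maps [A] into its complement, hence onto it by cardinality. So
    predecessors of vertices outside [A] lie in [A], and by injectivity so do their successors. *)
Lemma cycle_nbrs_independent (A : {set G}) x :
  {in A &, forall y z, ~~ edge y z} -> #|~: A| <= #|A| -> x \notin A ->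
  cycle_nbrs x \subset A.
Proof.
move=> indA leA xA; have Uc := ham_seq_uniq.
have injN : injective (next c) := can_inj (prev_next Uc).
have defB : next c @: A = ~: A.
  apply/eqP; rewrite eqEcard card_imset // leA andbT.
  apply/subsetP=> _ /imsetP[y Ay ->]; rewrite inE.
  by apply: contraL (edge_next y) => ANy; apply: indA.
apply/subsetP=> y; rewrite !inE => /orP[]/eqP->.
  apply: contraNT xA => NxA.
  have: next c x \in next c @: A by rewrite defB inE.
  by case/imsetP=> z Az /injN->.
have: x \in next c @: A by rewrite defB inE.
by case/imsetP=> z Az ->; rewrite prev_next.
Qed.

End HamiltonianSequences.

(** * The band graph *)

Section BandGraph.

Variables m d : nat.
Hypotheses (m_gt1 : 1 < m) (d_gt2 : 2 < d).

Let n := (m + d).+1.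

(** The clauses with [m <=] form the end block on the indices m, ..., m + d, where the band may run
    out of indices. Joining a_0 to the block raises its degree and lets a cycle close up. *)
Definition band_adj (i j : nat) : bool :=
  if i == 0 then (j == 0) || (m <= j)
  else (i <= j.+1) && (j < i + d.-1) || (m <= i) && (m <= j).

Definition band_edge : rel ('I_n + 'I_n) := fun x y =>
  match x, y with
  | inl _, inl _ => false
  | inl i, inr j => band_adj i j
  | inr j, inl i => band_adj i j
  | inr j, inr k => j != k
  end.

Lemma band_edge_sym : symmetric band_edge.
Proof. by case=> i [] j //=; rewrite eq_sym. Qed.

Lemma band_edge_irrefl : irreflexive band_edge.
Proof. by case=> i //=; rewrite eqxx. Qed.

Definition band_graph : sgraph := SGraph band_edge_sym band_edge_irrefl.

Let a (i : 'I_n) : band_graph := inl i.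
Let b (j : 'I_n) : band_graph := inr j.

Lemma card_band_graph : #|band_graph| = n + n.
Proof. by rewrite card_sum !card_ord. Qed.

Lemma card_ord_interval p q : p <= q <= n -> #|[set k : 'I_n | p <= k < q]| = q - p.
Proof.
move=> /andP[le_pq le_qn].
pose f (k : 'I_(q - p)) : 'I_n := inord (p + k).
have fE k : f k = p + k :> nat by rewrite inordK //; have := ltn_ord k; lia.
have injf : injective f.
  by move=> k l /(congr1 val); rewrite /= !fE => /addnI /val_inj.
rewrite -[RHS]card_ord -(card_imset predT injf); apply: eq_card => k.
rewrite inE; apply/idP/imsetP => [/andP[le_pk lt_kq]|[l _ ->]].
  have lt_l : k - p < q - p by lia.
  by exists (Ordinal lt_l) => //; apply: val_inj; rewrite /= fE /= subnKC.
by rewrite fE; have := ltn_ord l; lia.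
Qed.

(** * Minimum degree and connectivity *)

Lemma degree_aE (i : 'I_n) : degree (a i) = #|[set j : 'I_n | band_adj i j]|.
Proof.
have inj_b : injective b by move=> j k [].
rewrite /degree -(card_imset _ inj_b); apply: eq_card => -[j|j].
  by rewrite !inE; apply/esym/imsetP => -[].
by rewrite inE (mem_imset _ _ inj_b) inE.
Qed.

Lemma degree_a_ge (i : 'I_n) : d <= degree (a i).
Proof.
rewrite degree_aE; have lt_in := ltn_ord i.
have [i0|[[i_gt0 lt_im]|[i_gt0 le_mi]]] :
  i = 0 :> nat \/ (0 < i /\ i < m \/ 0 < i /\ m <= i) by lia.
(* For i = 0 and for m <= i, the vertices b_(m+1), ..., b_(m+d) of the block are d neighbours;
   otherwise the band b_(i-1), ..., b_(i+d-2) fits in the index range. *)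
- rewrite -[leqLHS](addKn m.+1) -card_ord_interval; last by lia.
  by apply/subset_leq_card/subsetP => j; rewrite !inE /band_adj i0 /=; lia.
- have -> : d = (i + d.-1) - i.-1 by lia.
  rewrite -card_ord_interval; last by lia.
  by apply/subset_leq_card/subsetP => j; rewrite !inE /band_adj; case: eqP => ?; lia.
- rewrite -[leqLHS](addKn m.+1) -card_ord_interval; last by lia.
  by apply/subset_leq_card/subsetP => j; rewrite !inE /band_adj; case: eqP => ?; lia.
Qed.

Lemma degree_b_ge (j : 'I_n) : d <= degree (b j).
Proof.
have inj_b : injective b by move=> k l [].
apply: leq_trans (_ : #|b @: [set~ j]| <= _).
  by rewrite card_imset // cardsC1 card_ord; lia.
apply/subset_leq_card/subsetP => _ /imsetP[k + ->].
by rewrite !inE /= eq_sym.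
Qed.

(** Since [1 < m], a_1 is outside the end block and sees only b_0, ..., b_(d-1), so it attains the
    minimum degree. *)
Lemma degree_a1 : degree (a (inord 1)) = d.
Proof.
rewrite degree_aE inordK; last by lia.
have -> : d = d - 0 by lia.
rewrite -card_ord_interval; last by lia.
by apply: eq_card => j; rewrite !inE /band_adj /=; lia.
Qed.

Lemma min_degree_band_graph : min_degree band_graph = d.
Proof.
apply/eqP; rewrite eqn_leq /min_degree; apply/andP; split.
  rewrite -[leqRHS]degree_a1; have := mem_index_enum (a (inord 1)).
  elim: (index_enum _) => // x r IHr; rewrite inE big_cons => /predU1P[->|/IHr].
    exact: geq_minl.
  exact: leq_trans (geq_minr _ _).
elim/big_ind: _ => [|x y|[i|j] _]; last exact: degree_b_ge.
- by rewrite card_band_graph; lia.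
- by rewrite leq_min => -> ->.
- exact: degree_a_ge.
Qed.

Lemma k_connected_band_graph : k_connected 3 band_graph.
Proof.
split=> [|S ltS]; first by rewrite card_band_graph; lia.
(* What survives of the clique B is still a clique, and a surviving a_i keeps one of its at least d
   > #|S| neighbours, all of them in B. *)
have toB x : x \notin S -> exists2 j, b j \notin S & connect (del_edge S) x (b j).
  case: x => [i|j] xS; last by exists j.
  have [y /andP[]]: exists y, (y \in [set y | edge (a i) y]) && (y \notin S).
    apply/existsP; apply: contraLR (degree_a_ge i); rewrite negb_exists => /forallP sub.
    rewrite -ltnNge (leq_ltn_trans (subset_leq_card _) (leq_trans ltS d_gt2)) //.
    by apply/subsetP => y Ny; have := sub y; rewrite Ny negbK.
  rewrite inE; case: y => // j edge_ij bS; exists j => //.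
  by apply: connect1; apply/and3P; split.
have symS := sym_connect_sym (del_edge_sym S).
move=> x y /toB[j jS xj] /toB[k kS yk].
apply: connect_trans xj _; rewrite symS; apply: connect_trans yk _.
have [->|neq_kj] := eqVneq k j; first exact: connect0.
by apply: connect1; apply/and3P; split.
Qed.

(** * The hamiltonian cycle a_0 b_0 a_1 b_1 ... a_(n-1) b_(n-1) *)

Definition band_cycle_nth (k : nat) : band_graph :=
  if odd k then b (inord k./2) else a (inord k./2).

Lemma ham_seq_band_cycle : ham_seq (mkseq band_cycle_nth (n + n)).
Proof.
apply/and3P; split; first by rewrite size_mkseq; lia.
  apply/andP; split; last first.
    apply/(uniqP (a ord0)) => k l; rewrite !inE size_mkseq => lt_k lt_l.
    rewrite !nth_mkseq // /band_cycle_nth.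
    by case: ifP => oddk; case: ifP => oddl // -[/(congr1 val)] /=;
      rewrite !inordK; lia.
  pose s := [seq band_cycle_nth i | i <- iota 1 (n + n).-1].
  have -> : mkseq band_cycle_nth (n + n) = band_cycle_nth 0 :: s.
    by rewrite /mkseq /s; have -> : n + n = (n + n).-1.+1 by lia.
  apply/(pathP (a ord0)) => k; rewrite size_rcons size_map size_iota => lt_k.
  rewrite nth_rcons -rcons_cons nth_rcons /= size_map size_iota lt_k.
  have -> : nth (a ord0) (band_cycle_nth 0 :: s) k = band_cycle_nth k.
    case: k lt_k => //= k lt_k; rewrite (nth_map 0) ?size_iota; last by lia.
    by rewrite nth_iota //; lia.
  case: ltnP => lt_k'.
    rewrite (nth_map 0) ?size_iota // nth_iota // add1n /band_cycle_nth /=.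
    by case: ifP => oddk /=; rewrite /band_adj !inordK; try case: eqP => ?; lia.
  (* The closing edge b_(n-1) a_0 exists because m <= n - 1. *)
  have -> : k = (n + n).-1 by lia.
  rewrite eqxx /band_cycle_nth.
  have -> : odd (n + n).-1 by lia.
  by rewrite /= /band_adj !inordK /=; lia.
apply/forallP => -[i|i]; apply/mapP; have lt_in := ltn_ord i.
  exists i.*2; first by rewrite mem_iota; lia.
  by rewrite /band_cycle_nth odd_double doubleK inord_val.
exists i.*2.+1; first by rewrite mem_iota; lia.
by rewrite /band_cycle_nth /= odd_double uphalf_double inord_val.
Qed.

Lemma hamiltonian_band_graph : hamiltonian band_graph.
Proof.
have size_c : size (mkseq band_cycle_nth (n + n)) == #|band_graph|.
  by rewrite size_mkseq card_band_graph.
exists (cycle_edges (Tuple size_c)); apply/imsetP; exists (Tuple size_c) => //.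
by rewrite inE; apply: ham_seq_band_cycle.
Qed.

(** * The forced path *)

Lemma cycle_nbrs_b c (j : 'I_n) x : @ham_seq band_graph c ->
  x \in cycle_nbrs c (b j) -> exists2 i, x = a i & band_adj i j.
Proof.
move=> ham_c xj; have edge_jx := edge_cycle_nbrs ham_c xj.
have inj_a : injective a by move=> i k [].
have inj_b : injective b by move=> i k [].
have memA y : (y \in a @: setT) = (if y is inl _ then true else false).
  case: y => i; first by rewrite (mem_imset _ _ inj_a) inE.
  by apply/imsetP => -[].
have indA : {in a @: setT &, forall y z, ~~ edge y z}.
  by move=> [i|i] [k|k]; rewrite !memA.
have leA : #|~: (a @: setT)| <= #|a @: setT|.
  by rewrite cardsCs setCK card_imset // cardsT card_band_graph card_ord addnK.
have bA : b j \notin a @: setT by rewrite memA.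
(* A is independent and makes up half of the vertices, so both cycle neighbours of b_j lie in A. *)
have := subsetP (cycle_nbrs_independent ham_c indA leA bA) x xj.
by rewrite memA; case: x xj edge_jx => // i _ adj_ij _; exists i.
Qed.

Lemma forced_cycle_nbrs c j : @ham_seq band_graph c -> j < m ->
  cycle_nbrs c (b (inord j)) = [set a (inord j); a (inord j.+1)].
Proof.
move=> ham_c; elim/ltn_ind: j => j IHj lt_jm.
apply/eqP; rewrite eqEcard (card_cycle_nbrs ham_c) cards2 ltnS leq_b1 andbT.
apply/subsetP => x xj.
have [i def_x] := cycle_nbrs_b ham_c xj.
rewrite inordK; last by lia.
rewrite /band_adj => adj_ij.
(* As j < m, the block clauses fail: adjacency gives i <= j + 1, and i = 0 only when j = 0. *)
have [eq_i|[eq_i|[i_gt0 lt_ij]]] : i = inord j \/ i = inord j.+1 \/ 0 < i /\ i < j.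
- suff [eq_ij|[eq_ij|]] : i = j :> nat \/ i = j.+1 :> nat \/ 0 < i /\ i < j.
  + by left; apply: val_inj; rewrite /= inordK //; lia.
  + by right; left; apply: val_inj; rewrite /= inordK //; lia.
  + by right; right.
  by case: eqP adj_ij; lia.
- by rewrite def_x eq_i !inE eqxx.
- by rewrite def_x eq_i !inE eqxx orbT.
(* Otherwise b_(i-1), b_i and b_j would be three cycle neighbours of a_i. *)
have nbr_i : b (inord i) \in cycle_nbrs c (a i).
  by rewrite -(cycle_nbrs_sym ham_c) IHj ?inord_val ?inE ?eqxx //; lia.
have nbr_i1 : b (inord i.-1) \in cycle_nbrs c (a i).
  rewrite -(cycle_nbrs_sym ham_c) IHj ?prednK //; try lia.
  by rewrite inord_val !inE eqxx orbT.
have nbr_j : b (inord j) \in cycle_nbrs c (a i).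
  by rewrite -(cycle_nbrs_sym ham_c) -def_x.
have neq_b k l : k < n -> l < n -> k != l -> b (inord k) != b (inord l).
  by move=> lt_k lt_l; apply: contraNneq => -[/(congr1 val)] /=; rewrite !inordK // => ->.
have: 3 <= #|cycle_nbrs c (a i)|.
  apply: leq_trans (_ : #|[set b (inord i.-1); b (inord i); b (inord j)]| <= _).
    by rewrite -setUA cardsU1 cards2 !inE negb_or !neq_b //; lia.
  by apply/subset_leq_card/subsetP => y; rewrite !inE -orbA => /or3P[]/eqP->;
    rewrite -in_set2.
by rewrite (card_cycle_nbrs ham_c).
Qed.

(** * Counting the hamiltonian cycles *)

Definition bip_edge (p : 'I_n * 'I_n) : {set band_graph} := [set b p.2; a p.1].

Definition forced_edges : {set {set band_graph}} :=
  bip_edge @: [set p : 'I_n * 'I_n |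
    (p.2 < m) && ((p.1 == p.2 :> nat) || (p.1 == p.2.+1 :> nat))].

Definition free_pairs : {set 'I_n * 'I_n} :=
  [set p : 'I_n * 'I_n | (m <= p.2) && band_adj p.1 p.2].

Lemma card_free_pairs : #|free_pairs| <= d.+1 * d.*2.+1.
Proof.
(* Here j - m <= d. A nonzero i satisfies m < i + d, by the band or by the block, so i + d - m is a
   true difference between 1 and 2d; the value 0 is left to code i = 0. *)
pose f (p : 'I_n * 'I_n) : 'I_d.+1 * 'I_d.*2.+1 :=
  (inord (p.2 - m), inord (if p.1 == 0 :> nat then 0 else p.1 + d - m)).
have injf : {in free_pairs &, injective f}.
  move=> [i j] [k l]; rewrite !inE /= => /andP[le_mj adj_ij] /andP[le_ml adj_kl].
  move=> [/(congr1 val) /= + /(congr1 val) /=].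
  have [] := (ltn_ord i, ltn_ord j); have [] := (ltn_ord k, ltn_ord l).
  move: adj_ij adj_kl; rewrite /band_adj => adj_ij adj_kl lt_k lt_l lt_i lt_j.
  rewrite !inordK; try by [lia | case: eqP; lia].
  move=> eq_jl eq_ik; congr (_, _); apply: val_inj => /=; last by lia.
  by move: adj_ij adj_kl eq_ik; case: (i =P 0 :> nat); case: (k =P 0 :> nat); lia.
rewrite -(card_in_imset injf).
by apply: leq_trans (max_card _) _; rewrite card_prod !card_ord.
Qed.

(** A cycle is thus determined by its free edges: each cycle edge joins some b_j to A, and it is
    forced if j < m and comes from a free pair otherwise. *)
Lemma cycle_edges_band_graph c : @ham_seq band_graph c ->
  cycle_edges c = forced_edges :|: cycle_edges c :&: bip_edge @: free_pairs.
Proof.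
move=> ham_c; apply/eqP; rewrite eqEsubset; apply/andP; split; last first.
  rewrite subUset subsetIl andbT; apply/subsetP => _ /imsetP[[i j] + ->].
  rewrite inE /= => /andP[lt_jm eq_ij]; apply: (cycle_nbrs_edge ham_c).
  rewrite /= -[j]inord_val (forced_cycle_nbrs ham_c lt_jm) -[i]inord_val.
  by rewrite !inE; case/orP: eq_ij => /eqP->; rewrite eqxx ?orbT.
suff bip j x : x \in cycle_nbrs c (b j) ->
    [set b j; x] \in forced_edges :|: bip_edge @: free_pairs.
  apply/subsetP => e e_c; rewrite in_setU in_setI e_c /= -in_setU.
  have [x ->] := cycle_edgesP ham_c _ e_c.
  case: x => [i|j]; last by apply: bip; rewrite !inE eqxx.
  (* An edge traversed from a_i is read from its other end, which lies in B. *)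
  have edge_ix := edge_next ham_c (a i).
  have: a i \in cycle_nbrs c (next c (a i)).
    by rewrite -(cycle_nbrs_sym ham_c) !inE eqxx.
  by rewrite setUC; case: (next c (a i)) edge_ix => // j _; apply: bip.
move=> xj; have [i def_x adj_ij] := cycle_nbrs_b ham_c xj.
rewrite {}def_x in xj *; rewrite inE.
have [le_mj|lt_jm] := leqP m j; apply/orP; [right | left].
  by apply/imsetP; exists (i, j); rewrite // inE le_mj.
apply/imsetP; exists (i, j) => //; rewrite inE /= lt_jm /=.
move: xj; rewrite -[j in b j]inord_val forced_cycle_nbrs // !inE.
by case/orP=> /eqP[->]; rewrite inordK ?eqxx ?orbT // ltnS ltn_addr.
Qed.

(** Each cycle is the forced part together with a subset of the free edges, whose number is bounded
    independently of [m]. *)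
Lemma card_ham_cycles_band_graph :
  #|ham_cycles band_graph| <= 2 ^ (d.+1 * d.*2.+1).
Proof.
pose X := bip_edge @: free_pairs.
apply: leq_trans (_ : #|[set forced_edges :|: E | E in powerset X]| <= _).
  apply/subset_leq_card/subsetP => _ /imsetP[c + ->]; rewrite inE => ham_c.
  apply/imsetP; exists (cycle_edges c :&: X); first by rewrite inE subsetIr.
  exact: cycle_edges_band_graph.
apply: leq_trans (leq_imset_card _ _) _; rewrite card_powerset leq_exp2l //.
exact: leq_trans (leq_imset_card _ _) card_free_pairs.
Qed.

End BandGraph.

Theorem theorem4 (d : nat) (hd : 3 <= d) :
  exists (c : nat) (G : nat -> sgraph),
    (forall i j : nat, i <> j -> ~ isomorphic (G i) (G j)) /\
    (forall i : nat,
       [/\ hamiltonian (G i),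
           k_connected 3 (G i),
           min_degree (G i) = d
         & #|ham_cycles (G i)| <= c]).
Proof.
(* The shift [k.+2] ensures [1 < m]; distinct indices give graphs of distinct orders. *)
exists (2 ^ (d.+1 * d.*2.+1)), (fun k => band_graph k.+2 d); split.
  by move=> i j neq_ij [f /bij_eq_card]; rewrite !card_band_graph; lia.
move=> i; split.
- exact: hamiltonian_band_graph.
- exact: k_connected_band_graph.
- exact: min_degree_band_graph.
- exact: card_ham_cycles_band_graph.
Qed.
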